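(* Let $A$ be a commutative ring, $k\ge1$, $\vec s=(n_1,\dots,n_k)$ a tuple of positive integers, $n=\min(n_1,\dots,n_k)-1$, and $X_\bullet=X_\bullet(\vec s;A)$ the diagonal simplicial tensor module. For $p\ge1$ and $0\le j\le p$, the rank of the $A$-module $R_{p,j}(X)=\bigcap_{i\in[p]\setminus\{j\}}\ker(d_i^p:X_p\to X_{p-1})$ is $$\operatorname{rank}R_{p,j}=\sum_{t=0}^{p}(-1)^t\binom pt\prod_{a=1}^k\bigl(M_a(p)+1-t\bigr),$$ where $M_a(p)=n_a-1-n+p$.
   Context: Notation: $[p]=\{0,\dots,p\}$. For a shape $\vec s=(n_1,\dots,n_k)$ of positive integers with $n=\min(n_1,\dots,n_k)-1$, put $M_a(p)=n_a-1-n+p$ (so $M_a(p)\ge p$) and $I_p=\prod_{a=1}^k[M_a(p)]$ for $p\ge 0$. Let $\delta_i^q:[q-1]\to[q]$ be the increasing injection missing $i$, and $\Delta_i^p=\prod_{a=1}^k\delta_i^{M_a(p)}:I_{p-1}\to I_p$ ($p\ge1$, $0\le i\le p$). The diagonal simplicial tensor module $X_\bullet(\vec s;A)$ has $X_p=A^{I_p}$ (all functions $T:I_p\to A$) and faces $d_i^p(T)=T\circ\Delta_i^p$; its degeneracies are $s_i^p(T)=T\circ\Sigma_i^p$ with $\Sigma_i^p=\prod_{a=1}^k\sigma_i^{M_a(p)}:I_{p+1}\to I_p$ ($p\ge0$, $0\le i\le p$), where $\sigma_i^q:[q+1]\to[q]$ is the nondecreasing surjection taking the value $i$ twice. The module $R_{p,j}(X)$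 is a free $A$-module. *)

(* Defs.v *)
From HB Require Import structures.
From mathcomp Require Import all_boot all_order all_algebra.
From mathcomp Require Import zify.
Set Implicit Arguments.
Unset Strict Implicit.
Unset Printing Implicit Defensive.
Import GRing.Theory.
Local Open Scope ring_scope.

(* In the identities, [inord i] is the index of value [i]; every index that   *)
(* occurs is in range under the stated bounds.                                *)
Record simplicial_module (A : comPzRingType) := SimplicialModule {
  simplices :> nat -> lmodType A;
  face : forall p, 'I_p.+2 -> {linear simplices p.+1 -> simplices p};
  degeneracy : forall p, 'I_p.+1 -> {linear simplices p -> simplices p.+1};
  face_face : forall p (i j : nat) (x : simplices p.+2), (i < j <= p.+2)%N ->
    face (inord i) (face (inord j) x) = face (inord j.-1) (face (inord i) x);
  degeneracy_degeneracy :
    forall p (i j : nat) (x : simplices p), (i <= j <= p)%N ->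
    degeneracy (inord i) (degeneracy (inord j) x) =
    degeneracy (inord j.+1) (degeneracy (inord i) x);
  face_degeneracy_lt :
    forall p (i j : nat) (x : simplices p.+1), (i < j <= p.+1)%N ->
    face (inord i) (degeneracy (inord j) x) =
    degeneracy (inord j.-1) (face (inord i) x);
  face_degeneracy_eq :
    forall p (i j : nat) (x : simplices p), (j <= i <= j.+1)%N -> (j <= p)%N ->
    face (inord i) (degeneracy (inord j) x) = x;
  face_degeneracy_gt :
    forall p (i j : nat) (x : simplices p.+1), (j.+1 < i <= p.+2)%N ->
    face (inord i) (degeneracy (inord j) x) =
    degeneracy (inord j) (face (inord i.-1) x)
}.

(* [face_kernel X j] is R_{p+1,j}(X), with p+1 >= 1 read off the type of j.   *)
Definition face_kernel (A : comPzRingType) (X : simplicial_module A) (p : nat)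
    (j : 'I_p.+2) : {pred X p.+1} :=
  [pred x | [forall i : 'I_p.+2, (i != j) ==> (face X i x == 0)]].
Arguments face_kernel {A} X {p} j _.

Lemma face_kernel_submod_closed (A : comPzRingType) (X : simplicial_module A)
    (p : nat) (j : 'I_p.+2) :
  submod_closed (face_kernel X j).
Proof.
split=> [|a x y /forallP xR /forallP yR]; apply/forallP => i; apply/implyP => ij.
  by rewrite linear0.
have /eqP x0 := implyP (xR i) ij; have /eqP y0 := implyP (yR i) ij.
by rewrite linearP x0 y0 scaler0 addr0.
Qed.

Section Rank.
Variables (A : comPzRingType) (V : lmodType A).

Definition is_basis (S : {pred V}) (r : nat) (b : 'I_r -> V) : Prop :=
  (forall i, b i \in S) /\
  (forall x, x \in S -> exists! c : {ffun 'I_r -> A}, x = \sum_i c i *: b i).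

Definition free_of_rank (S : {pred V}) (r : nat) : Prop :=
  exists b : 'I_r -> V, is_basis S b.

End Rank.

(* The zero ring, where every rank is attained, is the only exception.        *)
Lemma free_of_rank_unique (A : comNzRingType) (V : lmodType A) (S : {pred V})
    (r s : nat) :
  submod_closed S -> free_of_rank S r -> free_of_rank S s -> r = s.
Proof.
move=> clS; wlog: r s / (r < s)%N => [W Hr Hs|rs].
  by case: (ltngtP r s) => [lt|lt|//]; [exact: W|apply/esym/W].
move=> [b [bS bP]] [b' [b'S b'P]]; exfalso.
have /fin_all_exists [c cE] (i : 'I_s) :
    exists c : {ffun 'I_r -> A}, b' i = \sum_j c j *: b j.
  by have [c [? _]] := bP _ (b'S i); exists c.
have /fin_all_exists [d dE] (j : 'I_r) :
    exists d : {ffun 'I_s -> A}, b j = \sum_i d i *: b' i.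
  by have [d [? _]] := b'P _ (bS j); exists d.
have CD : (\matrix_(i, j) c i j) *m (\matrix_(j, i) d j i) = 1%:M :> 'M[A]_s.
  apply/matrixP => i k; rewrite !mxE.
  have [e [_ eU]] := b'P _ (b'S i).
  have e1 : e = [ffun k => (i == k)%:R].
    apply: eU; rewrite (bigD1 i) //= big1 ?ffunE ?eqxx ?scale1r ?addr0 //.
    by move=> l li; rewrite ffunE eq_sym (negPf li) scale0r.
  have e2 : e = [ffun k => \sum_j c i j * d j k].
    apply: eU; rewrite {1}cE.
    under eq_bigr => j _ do rewrite dE scaler_sumr.
    rewrite exchange_big /=; apply: eq_bigr => l _.
    by rewrite ffunE scaler_suml; apply: eq_bigr => j _; rewrite scalerA.
  have /ffunP/(_ k) : [ffun k => \sum_j c i j * d j k] = [ffun k => (i == k)%:R].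
    by rewrite -e1 -e2.
  by rewrite !ffunE => <-; apply: eq_bigr => j _; rewrite !mxE.
move: CD; set C := (\matrix_(i, j) c i j); set D := (\matrix_(j, i) d j i).
have [m sE] : exists m, s = (r + m.+1)%N.
  by exists (s - r).-1; lia.
clearbody C D; clear -sE; subst s => CD.
have : \det (row_mx C (0 : 'M_(r + m.+1, m.+1)) *m
             col_mx D (0 : 'M_(m.+1, r + m.+1))) = 1.
  by rewrite mul_row_col mul0mx addr0 CD det1.
rewrite det_mulmx (expand_det_col _ (rshift r ord0)) big1 ?mul0r.
  by move=> /esym/eqP; rewrite oner_eq0.
by move=> i _; rewrite row_mxEr mxE mul0r.
Qed.

Definition delta (q i : nat) : 'I_q -> 'I_q.+1 := lift (inord i).

Definition sigma (q i : nat) : 'I_q.+2 -> 'I_q.+1 := fun x => inord (unbump i x).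

Lemma deltaE (q i : nat) (x : 'I_q) : (i <= q)%N -> delta i x = bump i x :> nat.
Proof. by move=> iq; rewrite /= inordK. Qed.

Lemma sigmaE (q i : nat) (x : 'I_q.+2) :
  (i <= q)%N -> sigma i x = unbump i x :> nat.
Proof.
by move=> iq; rewrite inordK // /unbump; have := ltn_ord x; case: ltnP; lia.
Qed.

Section DiagonalTensor.
Variables (A : comPzRingType) (k : nat) (s : k.-tuple nat).

(* The integer n = min(n_1, ..., n_k) - 1, for k and all entries positive.    *)
Definition shape_dim : nat := (foldr minn (head 0%N s) s).-1.

(* M_a(p) = n_a - 1 - n + p. The natural subtraction is exact when all        *)
(* entries are positive; p comes first so that M_a(p+1) reduces to M_a(p)+1.  *)
Definition top_index (p : nat) (a : 'I_k) : nat :=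
  (p + ((tnth s a).-1 - shape_dim))%N.

Lemma top_indexE (p : nat) (a : 'I_k) :
  (forall b : 'I_k, (0 < tnth s b)%N) ->
  (top_index p a)%:Z = (tnth s a)%:Z - 1 - shape_dim%:Z + p%:Z.
Proof.
move=> s_gt0; have : (shape_dim <= (tnth s a).-1)%N.
  rewrite /shape_dim; have := mem_tnth a s; rewrite memtE.
  move: (head _ _) (tnth s a) => d m.
  elim: (val s) => [|x l IH] /=; first by rewrite in_nil.
  rewrite in_cons => /predU1P[->|/IH]; lia.
by have := s_gt0 a; rewrite /top_index; lia.
Qed.

Definition multi_index (p : nat) : finType :=
  {dffun forall a : 'I_k, 'I_(top_index p a).+1}.

Definition Delta (p i : nat) (x : multi_index p) : multi_index p.+1 :=
  [ffun a : 'I_k => delta i (x a) : 'I_(top_index p.+1 a).+1].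

Definition Sigma (p i : nat) (x : multi_index p.+1) : multi_index p :=
  [ffun a : 'I_k => sigma i (x a : 'I_(top_index p a).+2)].

Definition tensors (p : nat) : lmodType A := {ffun multi_index p -> A^o}.

Definition precomp (I J : finType) (f : I -> J) (T : {ffun J -> A^o}) :
  {ffun I -> A^o} := [ffun x => T (f x)].

Lemma precomp_is_linear (I J : finType) (f : I -> J) : linear (precomp f).
Proof. by move=> a S T; apply/ffunP => x; rewrite !ffunE. Qed.

HB.instance Definition _ (I J : finType) (f : I -> J) :=
  GRing.isLinear.Build A {ffun J -> A^o} {ffun I -> A^o} *:%R (precomp f)
    (precomp_is_linear f).

Definition tensor_face (p : nat) (i : 'I_p.+2) :
    {linear tensors p.+1 -> tensors p} :=
  precomp (@Delta p i).

Definition tensor_degeneracy (p : nat) (i : 'I_p.+1) :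
    {linear tensors p -> tensors p.+1} :=
  precomp (@Sigma p i).

Lemma leq_top_index (p : nat) (a : 'I_k) : (p <= top_index p a)%N.
Proof. exact: leq_addr. Qed.

Lemma index_eq (p : nat) (x y : multi_index p) :
  (forall a, x a = y a :> nat) -> x = y.
Proof. by move=> xy; apply/ffunP => a; apply: val_inj; apply: xy. Qed.

Lemma DeltaE (p i : nat) (x : multi_index p) (a : 'I_k) :
  (i <= p.+1)%N -> Delta i x a = bump i (x a) :> nat.
Proof.
by move=> ip; rewrite ffunE deltaE // (leq_trans ip) // (leq_top_index p.+1).
Qed.

Lemma SigmaE (p i : nat) (x : multi_index p.+1) (a : 'I_k) :
  (i <= p)%N -> Sigma i x a = unbump i (x a) :> nat.
Proof.
by move=> ip; rewrite ffunE sigmaE // (leq_trans ip) // leq_top_index.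
Qed.

Lemma tensor_face_face (p i j : nat) (T : tensors p.+2) : (i < j <= p.+2)%N ->
  tensor_face (inord i) (tensor_face (inord j) T) =
  tensor_face (inord j.-1) (tensor_face (inord i) T).
Proof.
move=> /andP[ij jp]; apply/ffunP => x; rewrite !ffunE !inordK; try lia.
congr (T _); apply: index_eq => a; rewrite !DeltaE ?/bump; try lia.
Qed.

Lemma tensor_degeneracy_degeneracy (p i j : nat) (T : tensors p) :
  (i <= j <= p)%N ->
  tensor_degeneracy (inord i) (tensor_degeneracy (inord j) T) =
  tensor_degeneracy (inord j.+1) (tensor_degeneracy (inord i) T).
Proof.
move=> /andP[ij jp]; apply/ffunP => x; rewrite !ffunE !inordK; try lia.
congr (T _); apply: index_eq => a; rewrite !SigmaE ?/unbump; try lia.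
Qed.

Lemma tensor_face_degeneracy_lt (p i j : nat) (T : tensors p.+1) :
  (i < j <= p.+1)%N ->
  tensor_face (inord i) (tensor_degeneracy (inord j) T) =
  tensor_degeneracy (inord j.-1) (tensor_face (inord i) T).
Proof.
move=> /andP[ij jp]; apply/ffunP => x; rewrite !ffunE !inordK; try lia.
congr (T _); apply: index_eq => a.
by rewrite ?(SigmaE, DeltaE) ?/unbump ?/bump; lia.
Qed.

Lemma tensor_face_degeneracy_eq (p i j : nat) (T : tensors p) :
  (j <= i <= j.+1)%N -> (j <= p)%N ->
  tensor_face (inord i) (tensor_degeneracy (inord j) T) = T.
Proof.
move=> /andP[ji ij] jp; apply/ffunP => x; rewrite !ffunE !inordK; try lia.
congr (T _); apply: index_eq => a.
by rewrite ?(SigmaE, DeltaE) ?/unbump ?/bump; lia.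
Qed.

Lemma tensor_face_degeneracy_gt (p i j : nat) (T : tensors p.+1) :
  (j.+1 < i <= p.+2)%N ->
  tensor_face (inord i) (tensor_degeneracy (inord j) T) =
  tensor_degeneracy (inord j) (tensor_face (inord i.-1) T).
Proof.
move=> /andP[ji ip]; apply/ffunP => x; rewrite !ffunE !inordK; try lia.
congr (T _); apply: index_eq => a.
by rewrite ?(SigmaE, DeltaE) ?/unbump ?/bump; lia.
Qed.

Definition diagonal_tensor_module : simplicial_module A :=
  SimplicialModule tensor_face_face tensor_degeneracy_degeneracy
    tensor_face_degeneracy_lt tensor_face_degeneracy_eq
    tensor_face_degeneracy_gt.

End DiagonalTensor.

(* Main.v *)
(** The image of [Delta i] consists of the multi-indices none of whose
    coordinates equals [i], so a tensor lies in [R_{p,j}] iff it is supported on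
    the multi-indices [x] in which every [i <> j] of [[p]] occurs as a
    coordinate.  These tensors have a basis of indicator functions, and the
    multi-indices are counted by inclusion-exclusion over the set of values
    [i <> j] that are avoided. *)

Require Import Defs.
From mathcomp Require Import all_boot all_order all_algebra.
From mathcomp Require Import zify.
Set Implicit Arguments.
Unset Strict Implicit.
Unset Printing Implicit Defensive.
Import GRing.Theory.
Local Open Scope ring_scope.

(** Summing over [x] reduces this to an identity of indicators: that of the left-hand set is the
    product over [i] of [1 - (x \in B i)], which expands into a sum over the set [S] of factors
    where the second term is chosen. *)
Lemma inclusion_exclusion (I X : finType) (B : I -> {set X}) :
  #|[set x | [forall i, x \notin B i]]|%:Z =
  \sum_(S : {set I}) (-1) ^+ #|S| * #|[set x | [forall i in S, x \in B i]]|%:Z.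
Proof.
have boolZ (C : {set X}) : #|C|%:Z = \sum_x (x \in C)%:R :> int.
  rewrite -sum1_card -[LHS]natz natr_sum [LHS]big_mkcond.
  by apply: eq_bigr => x _; case: ifP.
rewrite boolZ; under [RHS]eq_bigr => S _ do rewrite boolZ mulr_sumr.
rewrite exchange_big; apply: eq_bigr => x _ /=.
transitivity (\prod_(i : I) (- (x \in B i)%:R + 1) : int).
  rewrite inE; case: forallP => [xB | /forallP/forallPn[i]].
    by rewrite big1 // => i _; rewrite (negPf (xB i)) oppr0 add0r.
  by rewrite negbK => xi; rewrite (bigD1 i) //= xi addNr mul0r.
rewrite bigA_distr; apply: eq_bigr => S _; rewrite -big_mkcond prodrN inE.
congr (_ * _); case: forall_inP => [xB | /forall_inP/forall_inPn[i iS xi]].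
  by rewrite big1 // => i /xB ->.
by rewrite (bigD1 i) //= (negPf xi) mul0r.
Qed.

Lemma sum_card_set (I : finType) (V : zmodType) (F : nat -> V) :
  \sum_(S : {set I}) F #|S| = \sum_(t < #|I|.+1) F t *+ 'C(#|I|, t).
Proof.
(* Group the sets by cardinality; [inord] is faithful here because [#|S| <= #|I|]. *)
rewrite (partition_big (fun S : {set I} => inord #|S| : 'I_#|I|.+1) xpredT) //.
apply: eq_bigr => t _; rewrite -card_draws -sumr_const.
have inordS (S : {set I}) : (inord #|S| == t) = (#|S| == t :> nat).
  by rewrite -val_eqE /= inordK // ltnS max_card.
by apply: eq_big => [S|S]; rewrite ?inE inordS // => /eqP ->.
Qed.

(** The coordinates are constrained independently: [x a] ranges over the complement of [f a @: S],
    and injectivity of [f a] makes that image as large as [S]. *)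
Lemma card_avoiding (I K : finType) (T : K -> finType)
    (f : forall a, I -> T a) (S : {set I}) :
  (forall a, injective (f a)) ->
  #|[set x : {dffun forall a, T a} |
       [forall i in S, [forall a, x a != f a i]]]|%:Z =
  \prod_(a : K) (#|T a|%:Z - #|S|%:Z).
Proof.
move=> f_inj; pose F a : pred (T a) := mem (~: (f a @: S)).
have -> : #|[set x : {dffun forall a, T a} |
              [forall i in S, [forall a, x a != f a i]]]| =
      #|(family F : simpl_pred {dffun forall a, T a})|.
  apply: eq_card => x; rewrite inE; apply/forall_inP/familyP => [xS a | xF i iS].
    apply/setCP => /imsetP[i iS xE].
    by have /forallP/(_ a) := xS i iS; rewrite xE eqxx.
  apply/forallP => a; apply: contraTN (xF a) => /eqP xE.
  by rewrite inE; apply/negPn/imsetP; exists i.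
rewrite card_family foldrE big_image -[LHS]natz natr_prod /=.
apply: eq_bigr => a _.
have <- : #|~: (f a @: S)| = #|F a| by apply: eq_card.
by rewrite natz -(cardsC (f a @: S)) card_imset // PoszD addrC addKr.
Qed.

Lemma card_covering (I K : finType) (T : K -> finType) (f : forall a, I -> T a) :
  (forall a, injective (f a)) ->
  #|[set x : {dffun forall a, T a} |
       [forall i, [exists a, x a == f a i]]]|%:Z =
  \sum_(t < #|I|.+1) (-1) ^+ t * 'C(#|I|, t)%:Z *
    \prod_(a : K) (#|T a|%:Z - t%:Z).
Proof.
move=> f_inj.
pose B i := [set x : {dffun forall a, T a} | [forall a, x a != f a i]].
have -> : [set x : {dffun forall a, T a} | [forall i, [exists a, x a == f a i]]]
    = [set x | [forall i, x \notin B i]].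
  apply/setP => x; rewrite !inE; apply: eq_forallb => i.
  by rewrite inE negb_forall; apply: eq_existsb => a; rewrite negbK.
rewrite inclusion_exclusion.
have avoid (S : {set I}) : #|[set x | [forall i in S, x \in B i]]|%:Z =
    \prod_a (#|T a|%:Z - #|S|%:Z).
  rewrite -(card_avoiding S f_inj); congr Posz; apply: eq_card => x.
  by rewrite !inE; apply: eq_forallb => i; rewrite inE.
under eq_bigr => S _ do rewrite avoid.
rewrite (sum_card_set _ (fun t => (-1) ^+ t * \prod_a (#|T a|%:Z - t%:Z))).
by apply: eq_bigr => t _; rewrite mulrAC -[LHS]mulr_natr natz.
Qed.

(** The indicators of the points of [D] form a basis, and the coefficients of [T] are its values on
    [D]. *)
Lemma free_of_rank_supported (A : comPzRingType) (X : finType) (D : {set X})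
    (S : {pred {ffun X -> A^o}}) :
  (forall T : {ffun X -> A^o},
     reflect (forall x, x \notin D -> T x = 0) (T \in S)) ->
  free_of_rank S #|D|.
Proof.
move=> SP; pose b (i : 'I_#|D|) : {ffun X -> A^o} :=
  [ffun x => (x == enum_val i)%:R].
have sumE (c : 'I_#|D| -> A) i : (\sum_l c l *: b l) (enum_val i) = c i.
  rewrite sum_ffunE (bigD1 i) //= big1 => [|l li].
    by rewrite !ffunE eqxx addr0 [LHS]mulr1.
  by rewrite !ffunE (inj_eq enum_val_inj) eq_sym (negPf li) [LHS]mulr0.
exists b; split=> [i | T /SP TD].
  apply/SP => x xD; rewrite ffunE; case: eqP => // xE.
  by rewrite xE enum_valP in xD.
exists [ffun i => T (enum_val i)]; split=> [|c ->]; last first.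
  by apply/ffunP => i; rewrite ffunE sumE.
apply/ffunP => x; case: (boolP (x \in D)) => [xD | xD].
  by rewrite -(enum_rankK_in xD xD) sumE ffunE.
rewrite TD // sum_ffunE big1 // => i _; rewrite !ffunE.
by case: eqP => [xE | _]; [rewrite xE enum_valP in xD | exact: mulr0].
Qed.

Lemma Delta_image (k : nat) (s : k.-tuple nat) (p i : nat)
    (x : multi_index s p.+1) :
  (i <= p.+1)%N ->
  (exists y : multi_index s p, x = Delta i y) <-> (forall a, x a != i :> nat).
Proof.
move=> ip; split=> [[y ->] a | xi].
  by rewrite DeltaE // eq_sym neq_bump.
(* [inord] does not truncate: if [x a] is the top value, then [i], being in range and different from
   it, lies below, so [unbump] lowers it. *)
exists [ffun a => inord (unbump i (x a))]; apply: index_eq => a.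
have xa_lt : (x a < (top_index s p a).+2)%N by exact: ltn_ord.
have xai := xi a; have p_le := leq_top_index s p a.
by rewrite DeltaE // ffunE inordK; rewrite /bump /unbump; lia.
Qed.

(** A face [i] kills [T] iff [T] vanishes on the image of [Delta i]. The indices other than [j] are
    enumerated by [lift j], which gives an index type with exactly [p.+1] elements for the later
    count. *)
Lemma face_kernelP (A : comPzRingType) (k : nat) (s : k.-tuple nat) (p : nat)
    (j : 'I_p.+2) (T : tensors A s p.+1) :
  reflect (forall x : multi_index s p.+1,
             ~~ [forall i : 'I_p.+1, [exists a, x a == lift j i :> nat]] ->
             T x = 0)
    (T \in face_kernel (diagonal_tensor_module A s) j).
Proof.
apply: (iffP forallP) => [TR x /forallPn[i /existsPn xi] | TR i].
  have /implyP := TR (lift j i); rewrite eq_sym neq_lift => /(_ isT)/eqP Ti.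
  have [|y ->] := (Delta_image x (_ : lift j i <= p.+1)%N).2 xi.
    by rewrite -ltnS ltn_ord.
  by move/ffunP/(_ y): Ti; rewrite !ffunE.
apply/implyP; case: (unliftP j i) => [l -> _ | ->]; last by rewrite eqxx.
apply/eqP/ffunP => y; rewrite !ffunE; apply: TR.
apply/forallPn; exists l; apply/existsPn.
by apply/Delta_image; [rewrite -ltnS ltn_ord | exists y].
Qed.

Theorem proposition5p4 (A : comPzRingType) (k : nat) (s : k.-tuple nat)
    (hk : (0 < k)%N) (hs : forall a : 'I_k, (0 < tnth s a)%N)
    (p : nat) (j : 'I_p.+2) :
  exists r : nat,
    free_of_rank (face_kernel (diagonal_tensor_module A s) j) r /\
    r%:Z = \sum_(t < p.+2) (-1) ^+ t * ('C(p.+1, t))%:Z *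
             \prod_(a < k) ((top_index s p.+1 a)%:Z + 1 - t%:Z).
Proof.
(* The value [lift j i] seen in the range of coordinate [a]; it fits because
   [p.+1 <= top_index s p.+1 a]. *)
pose f a (i : 'I_p.+1) : 'I_(top_index s p.+1 a).+1 := inord (lift j i).
have fE a i : f a i = lift j i :> nat.
  by rewrite inordK // ltnS (leq_trans _ (leq_top_index s _ a)) // -ltnS.
have f_inj a : injective (f a).
  by move=> i l /(congr1 (@nat_of_ord _)); rewrite !fE => /val_inj/lift_inj.
pose D := [set x : multi_index s p.+1 | [forall i, [exists a, x a == f a i]]].
have DE x : (x \in D) = [forall i : 'I_p.+1, [exists a, x a == lift j i :> nat]].
  rewrite inE; apply: eq_forallb => i; apply: eq_existsb => a.
  by rewrite -(fE a).
exists #|D|; split.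
  apply: free_of_rank_supported => T.
  by apply: (iffP (face_kernelP j T)) => TD x; [rewrite DE | rewrite -DE];
     apply: TD.
rewrite card_covering // card_ord; apply: eq_bigr => t _; congr (_ * _).
by apply: eq_bigr => a _; rewrite card_ord -addn1 PoszD.
Qed.
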